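(* Let $1 \to N \to G \stackrel{\pi}{\to} H \to 1$ be a central extension (a short exact sequence of groups with $N \le Z(G)$). Then the sequence $$1 \to \mathrm{Aut}^{N,H}(G) \to \mathrm{Aut}_N(G) \stackrel{\tau}{\to} \mathrm{Aut}(N)\times\mathrm{Aut}(H) \stackrel{\lambda}{\to} H^2(H,N)$$ is exact, where the map $\mathrm{Aut}^{N,H}(G)\to \mathrm{Aut}_N(G)$ is the inclusion, and exactness at $\mathrm{Aut}(N)\times\mathrm{Aut}(H)$ means that the image of $\tau$ equals $\{(\theta,\phi) : \lambda(\theta,\phi)=1\}$ (the map $\lambda$ need not be a homomorphism).
   Context: $N$ is regarded as a central subgroup of $G$ and $H\cong G/N$. $\mathrm{Aut}_N(G)$ is the group of automorphisms $\gamma$ of $G$ with $\gamma(N)=N$; $\mathrm{Aut}^{N,H}(G)$ is the group of automorphisms of $G$ fixing $N$ elementwise and inducing the identity on $H$. The homomorphism $\tau$ sends $\gamma$ to $(\theta,\phi)$, where $\theta$ is the restriction of $\gamma$ to $N$ and $\phi$ is the automorphism of $H$ induced by $\gamma$. $H$ acts trivially on $N$. Groups are written multiplicatively. Fix a left transversal $t:H\to G$ (so $\pi(t(x))=x$) with $t(1)=1$, and define $\mu:H\times H\to N$ by $t(xy)\mu(x,y)=t(x)t(y)$. A normalized $2$-cocycle is a map $f:H\times H\to N$ with $f(x,1)=f(1,x)=1$ and $f(xy,z)f(x,y)=f(x,yz)f(y,z)$; a $2$-coboundary is a map $(x,y)\mapsto\chi(x)\chi(y)\chi(xy)^{-1}$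 with $\chi:H\to N$, $\chi(1)=1$; $H^2(H,N)$ is the quotient group of cocycles by coboundaries. For $(\theta,\phi)\in\mathrm{Aut}(N)\times\mathrm{Aut}(H)$, $\lambda(\theta,\phi)$ is the class in $H^2(H,N)$ of the normalized $2$-cocycle $k_{\theta,\phi}(x,y)=\mu(\phi(x),\phi(y))\,\theta(\mu(x,y))^{-1}$. This class does not depend on the choice of $t$. *)

(* Defs.v *)
(* Groups are abstract, possibly infinite [groupType]s; [boolp] and
   [classical_sets] are used only for classical reasoning and choice. *)
From HB Require Import structures.
From mathcomp Require Import all_boot generic_quotient.
From mathcomp Require Import boolp classical_sets.

Set Implicit Arguments.
Unset Strict Implicit.
Unset Printing Implicit Defensive.

Local Open Scope classical_set_scope.
Local Open Scope quotient_scope.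
Local Open Scope group_scope.

(* Only the unit of [B] is used, so that exactness makes sense for a function
   into (the underlying pointed set of) a group that is not a homomorphism. *)
Definition ker (A : Type) (B : groupType) (f : A -> B) : set A :=
  [set x | f x = 1].

Definition exact_at (A : Type) (B C : groupType) (f : A -> B) (g : B -> C) : Prop :=
  range f = ker g.

Lemma mulg_morph1 (G H : groupType) (f : G -> H) :
  {morph f : x y / x * y} -> f 1 = 1.
Proof.
by move=> fM; apply: (mulIg (f 1)); rewrite -fM !mul1g.
Qed.

Lemma mulg_morphV (G H : groupType) (f : G -> H) :
  {morph f : x y / x * y} -> {morph f : x / x^-1}.
Proof.
move=> fM x; apply: (mulIg (f x)).
by rewrite -fM !mulVg mulg_morph1.
Qed.

Section AutomorphismGroup.
Variable G : groupType.

Definition is_aut (f : G -> G) : Prop :=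
  bijective f /\ {morph f : x y / x * y}.

Record aut : Type := Aut {
  aut_fun :> G -> G;
  aut_funP : `[< is_aut aut_fun >]
}.

HB.instance Definition _ := [isSub for aut_fun].
HB.instance Definition _ := [Choice of aut by <:].

Implicit Types a b c : aut.

Lemma autP a : is_aut a. Proof. exact/asboolP/aut_funP. Qed.
Lemma autM a : {morph a : x y / x * y}. Proof. by case: (autP a). Qed.
Lemma aut_bij a : bijective a. Proof. by case: (autP a). Qed.
Lemma aut_inj a : injective a. Proof. exact: bij_inj (aut_bij a). Qed.
Lemma aut1 a : a 1 = 1. Proof. exact: mulg_morph1 (autM a). Qed.
Lemma autV a : {morph a : x / x^-1}. Proof. exact: mulg_morphV (autM a). Qed.

Lemma aut_ext a b : a =1 b -> a = b.
Proof. by move=> ab; apply/val_inj/funext. Qed.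

Definition mk_aut (f : G -> G) (fP : is_aut f) : aut :=
  Aut (introT (asboolP _) fP).

Lemma is_aut_id : is_aut idfun.
Proof. by split=> //; exists idfun. Qed.

Lemma is_aut_comp a b : is_aut (a \o b).
Proof.
split; first exact: bij_comp (aut_bij a) (aut_bij b).
by move=> x y /=; rewrite !autM.
Qed.

Definition aut_inv_fun a (y : G) : G := xget 1 [set x | a x = y].

Lemma aut_invK a : cancel (aut_inv_fun a) a.
Proof.
move=> y; have [g _ gK] := aut_bij a.
exact: (@xgetI _ 1 [set x | a x = y] (g y) (gK y)).
Qed.

Lemma autK a : cancel a (aut_inv_fun a).
Proof. by move=> x; apply: (@aut_inj a); rewrite aut_invK. Qed.

Lemma is_aut_inv a : is_aut (aut_inv_fun a).
Proof.
split; first by exists a; [exact: aut_invK | exact: autK].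
by move=> x y; apply: (@aut_inj a); rewrite autM !aut_invK.
Qed.

Definition aut_id := mk_aut is_aut_id.
Definition aut_mul a b := mk_aut (is_aut_comp a b).
Definition aut_inv a := mk_aut (is_aut_inv a).

Lemma aut_mulA : associative aut_mul.
Proof. by move=> a b c; apply: aut_ext. Qed.
Lemma aut_mul1 : left_id aut_id aut_mul.
Proof. by move=> a; apply: aut_ext. Qed.
Lemma aut_1mul : right_id aut_id aut_mul.
Proof. by move=> a; apply: aut_ext. Qed.
Lemma aut_mulV : left_inverse aut_id aut_inv aut_mul.
Proof. by move=> a; apply: aut_ext => x /=; rewrite autK. Qed.
Lemma aut_Vmul : right_inverse aut_id aut_inv aut_mul.
Proof. by move=> a; apply: aut_ext => x /=; rewrite aut_invK. Qed.

HB.instance Definition _ :=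
  isGroup.Build aut aut_mulA aut_mul1 aut_1mul aut_mulV aut_Vmul.

Lemma aut_mulE a b x : (a * b) x = a (b x). Proof. by []. Qed.
Lemma aut_1E x : (1 : aut) x = x. Proof. by []. Qed.
Lemma aut_VK a x : a^-1 (a x) = x. Proof. exact: autK. Qed.
Lemma aut_KV a x : a (a^-1 x) = x. Proof. exact: aut_invK. Qed.

End AutomorphismGroup.

(* The central subgroup is the image of the injection [i], with which [N] is
   identified. *)
Record central_extension (N G H : groupType)
    (i : UMagmaMorphism.type N G) (p : UMagmaMorphism.type G H) : Prop := {
  ext_inj : injective i;
  ext_exact : exact_at i p;
  ext_surj : forall h, exists g, p g = h;
  ext_central : forall n g, commute (i n) g
}.

Section Subgroups.
Variables (N G H : groupType).
Variables (i : UMagmaMorphism.type N G) (p : UMagmaMorphism.type G H).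

Definition stab_pred : pred (aut G) :=
  fun a => `[< a @` range i = range i >].

Definition fix_pred : pred (aut G) :=
  fun a => `[< (forall n, a (i n) = i n) /\ (forall g, p (a g) = p g) >].

Lemma stab_group_closed : group_closed stab_pred.
Proof.
split; first by apply/asboolP; rewrite image_id.
move=> a b /asboolP aN /asboolP bN; apply/asboolP.
have bV : b^-1 @` range i = range i.
  apply/seteqP; split=> x; first by rewrite -{1}bN => -[_ [y Ny <-] <-]; rewrite aut_VK.
  by move=> Nx; exists (b x); [rewrite -bN; exists x | rewrite aut_VK].
by rewrite -[RHS]aN -[in RHS]bV -image_comp.
Qed.

Lemma fix_group_closed : group_closed fix_pred.
Proof.
split; first exact/asboolP.
move=> a b /asboolP[aN aH] /asboolP[bN bH]; apply/asboolP.
by split=> [n|g]; rewrite aut_mulE;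
  [rewrite -{1}(bN n) aut_VK | rewrite aH -[RHS](congr1 p (aut_KV b g)) bH].
Qed.

Record autN : Type := AutN { autN_val :> aut G; autN_valP : stab_pred autN_val }.
HB.instance Definition _ := [isSub for autN_val].
HB.instance Definition _ := [Choice of autN by <:].
HB.instance Definition _ :=
  SubChoice_isSubGroup.Build (aut G) stab_pred autN stab_group_closed.

Record autNH : Type := AutNH { autNH_val :> aut G; autNH_valP : fix_pred autNH_val }.
HB.instance Definition _ := [isSub for autNH_val].
HB.instance Definition _ := [Choice of autNH by <:].
HB.instance Definition _ :=
  SubChoice_isSubGroup.Build (aut G) fix_pred autNH fix_group_closed.

Lemma autN_stab (a : autN) : a @` range i = range i.
Proof. exact/asboolP/(autN_valP a). Qed.

Lemma autNH_stab (a : autNH) : stab_pred a.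
Proof.
have /asboolP[aN _] := autNH_valP a; apply/asboolP/seteqP; split=> x.
  by move=> [_ [n _ <-] <-]; exists n.
by move=> [n _ <-]; exists (i n); [exists n | rewrite aN].
Qed.

Definition incl (a : autNH) : autN := AutN (autNH_stab a).

Lemma incl_morphism : monoid_morphism incl.
Proof. by split=> [|a b]; apply: val_inj. Qed.

HB.instance Definition _ := isUMagmaMorphism.Build autNH autN incl incl_morphism.

End Subgroups.

Section SecondCohomology.
Variables (H N : groupType).

Definition is_cocycle (f : H -> H -> N) : Prop :=
  [/\ forall x, f x 1 = 1,
      forall x, f 1 x = 1
    & forall x y z, f (x * y) z * f x y = f x (y * z) * f y z].

(* [cN] is a parameter of the type only so that the group structure below,
   which requires [N] to be commutative, can be canonical. *)
Record cocycle (cN : commutative (@mul N)) : Type := Cocycle {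
  cocycle_fun :> H -> H -> N;
  cocycle_funP : `[< is_cocycle cocycle_fun >]
}.

Variable cN : commutative (@mul N).
Local Notation Z2 := (cocycle cN).

HB.instance Definition _ := [isSub of Z2 for @cocycle_fun cN].
HB.instance Definition _ := [Choice of Z2 by <:].

Implicit Types f g : Z2.

Lemma cocycleP f : is_cocycle f. Proof. exact/asboolP/cocycle_funP. Qed.

Lemma cocycle_ext f g : (forall x y, f x y = g x y) -> f = g.
Proof. by move=> fg; apply/val_inj/funext => x; apply/funext => y; exact: fg. Qed.

Definition mk_cocycle (f : H -> H -> N) (fP : is_cocycle f) : Z2 :=
  Cocycle cN (introT (asboolP _) fP).

Lemma mulgACA_comm (a b c d : N) : (a * b) * (c * d) = (a * c) * (b * d).
Proof. by rewrite -!mulgA; congr (a * _); rewrite !mulgA (cN b). Qed.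

Lemma invgM_comm (a b : N) : (a * b)^-1 = a^-1 * b^-1.
Proof. by rewrite invgM cN. Qed.

Lemma is_cocycle_one : is_cocycle (fun _ _ => 1).
Proof. by []. Qed.

Lemma is_cocycle_mul f g : is_cocycle (fun x y => f x y * g x y).
Proof.
have [fr fl fM] := cocycleP f; have [gr gl gM] := cocycleP g.
split=> [x|x|x y z]; rewrite ?(fr, gr, fl, gl) ?mulg1 //.
by rewrite mulgACA_comm fM gM mulgACA_comm.
Qed.

Lemma is_cocycle_inv f : is_cocycle (fun x y => (f x y)^-1).
Proof.
have [fr fl fM] := cocycleP f.
split=> [x|x|x y z]; rewrite ?(fr, fl) ?invg1 //.
by rewrite -!invgM_comm fM.
Qed.

Definition cocycle_one := mk_cocycle is_cocycle_one.
Definition cocycle_mul f g := mk_cocycle (is_cocycle_mul f g).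
Definition cocycle_inv f := mk_cocycle (is_cocycle_inv f).

Lemma cocycle_mulA : associative cocycle_mul.
Proof. by move=> f g h; apply: cocycle_ext => x y /=; rewrite mulgA. Qed.
Lemma cocycle_mul1 : left_id cocycle_one cocycle_mul.
Proof. by move=> f; apply: cocycle_ext => x y /=; rewrite mul1g. Qed.
Lemma cocycle_1mul : right_id cocycle_one cocycle_mul.
Proof. by move=> f; apply: cocycle_ext => x y /=; rewrite mulg1. Qed.
Lemma cocycle_mulV : left_inverse cocycle_one cocycle_inv cocycle_mul.
Proof. by move=> f; apply: cocycle_ext => x y /=; rewrite mulVg. Qed.
Lemma cocycle_Vmul : right_inverse cocycle_one cocycle_inv cocycle_mul.
Proof. by move=> f; apply: cocycle_ext => x y /=; rewrite mulgV. Qed.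

HB.instance Definition _ := isGroup.Build Z2
  cocycle_mulA cocycle_mul1 cocycle_1mul cocycle_mulV cocycle_Vmul.

Lemma cocycle_mulC : commutative (@mul Z2).
Proof. by move=> f g; apply: cocycle_ext => x y; rewrite /= cN. Qed.

Definition is_coboundary (f : H -> H -> N) : Prop :=
  exists chi : H -> N,
    chi 1 = 1 /\ forall x y, f x y = chi x * chi y * (chi (x * y))^-1.

Definition coboundary_pred : pred Z2 := fun f => `[< is_coboundary f >].

Lemma coboundary_group_closed : group_closed coboundary_pred.
Proof.
split.
  by apply/asboolP; exists (fun=> 1); split=> // x y; rewrite invg1 !mulg1.
move=> f g /asboolP[c [c1 fc]] /asboolP[d [d1 gd]]; apply/asboolP.
exists (fun x => c x / d x); split; first by rewrite c1 d1 divgg.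
move=> x y; rewrite [LHS](_ : _ = f x y / g x y) // fc gd.
by rewrite !invgM_comm [in RHS](mulgACA_comm (c x) (d x)^-1) [RHS]mulgACA_comm.
Qed.

HB.instance Definition _ := isMulClosed.Build Z2 coboundary_pred
  (group_closedM coboundary_group_closed).
HB.instance Definition _ := isMul1Closed.Build Z2 coboundary_pred
  (fst coboundary_group_closed).
HB.instance Definition _ := isInvClosed.Build Z2 coboundary_pred
  (group_closedV coboundary_group_closed).

Definition cohomologous : rel Z2 := fun f g => f / g \in coboundary_pred.

Lemma cohomologous_equiv : equiv_class_of cohomologous.
Proof.
split=> [f|f g|g f h]; rewrite /cohomologous ?divgg ?gpred1 //.
  exact: gpredFC.
by move=> fg gh; rewrite -[f](mulgVK g) -mulgA gpredM.
Qed.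

Canonical cohomologous_equivRel := EquivRelPack cohomologous_equiv.
Canonical cohomologous_encModRel := defaultEncModRel cohomologous.

Definition H2 := {eq_quot cohomologous}.
HB.instance Definition _ : EqQuotient Z2 cohomologous H2 := EqQuotient.on H2.
HB.instance Definition _ := Choice.on H2.


Lemma H2_eqP f g : reflect (\pi_H2 f = \pi_H2 g) (f / g \in coboundary_pred).
Proof. by apply: (iffP idP) => [fg|/eqP]; [apply/eqP|]; rewrite piE. Qed.

Definition H2_one : H2 := \pi_H2 1.
Definition H2_mul (u v : H2) : H2 := \pi_H2 (repr u * repr v).
Definition H2_inv (u : H2) : H2 := \pi_H2 (repr u)^-1.

Lemma pi_H2M f g : H2_mul (\pi f) (\pi g) = \pi_H2 (f * g).
Proof.
have /H2_eqP hf : \pi_H2 (repr (\pi_H2 f)) = \pi_H2 f by rewrite reprK.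
have /H2_eqP hg : \pi_H2 (repr (\pi_H2 g)) = \pi_H2 g by rewrite reprK.
apply/H2_eqP; rewrite invgM (cocycle_mulC g^-1) -mulgA.
by rewrite (mulgA (repr (\pi_H2 g))) (cocycle_mulC (repr (\pi_H2 g))) -mulgA mulgA gpredM.
Qed.

Lemma pi_H2V f : H2_inv (\pi f) = \pi_H2 f^-1.
Proof.
have /H2_eqP hf : \pi_H2 (repr (\pi_H2 f)) = \pi_H2 f by rewrite reprK.
by apply/H2_eqP; rewrite -invgM gpredV cocycle_mulC.
Qed.

Lemma H2_mulA : associative H2_mul.
Proof. by move=> u v w; rewrite -[u]reprK -[v]reprK -[w]reprK !pi_H2M mulgA. Qed.
Lemma H2_mul1 : left_id H2_one H2_mul.
Proof. by move=> u; rewrite -[u]reprK pi_H2M mul1g. Qed.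
Lemma H2_1mul : right_id H2_one H2_mul.
Proof. by move=> u; rewrite -[u]reprK pi_H2M mulg1. Qed.
Lemma H2_mulV : left_inverse H2_one H2_inv H2_mul.
Proof. by move=> u; rewrite -[u]reprK pi_H2V pi_H2M mulVg. Qed.
Lemma H2_Vmul : right_inverse H2_one H2_inv H2_mul.
Proof. by move=> u; rewrite -[u]reprK pi_H2V pi_H2M mulgV. Qed.

HB.instance Definition _ :=
  isGroup.Build H2 H2_mulA H2_mul1 H2_1mul H2_mulV H2_Vmul.

Definition coh_class f : H2 := \pi_H2 f.

Lemma coh_class_morphism : monoid_morphism coh_class.
Proof. by split=> [|f g]; [|exact: esym (pi_H2M f g)]. Qed.

HB.instance Definition _ := isUMagmaMorphism.Build Z2 H2 coh_class coh_class_morphism.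

Lemma coh_class_eq1 f : coh_class f = 1 <-> is_coboundary f.
Proof.
rewrite -(asboolE (is_coboundary f)).
have -> : `[< is_coboundary f >] = (f / 1 \in coboundary_pred) by rewrite divg1.
by split=> /H2_eqP.
Qed.

End SecondCohomology.

Section CentralExtension.
Variables (N G H : groupType).
Variables (i : UMagmaMorphism.type N G) (p : UMagmaMorphism.type G H).

(* The inverse of [i] on the image of [i], and [1] elsewhere. *)
Definition ext_pull (g : G) : N := xget 1 [set n | i n = g].

Hypothesis e : central_extension i p.

Lemma ext_pullK g : p g = 1 -> i (ext_pull g) = g.
Proof.
move=> pg; have : range i g by rewrite (ext_exact e).
by move=> [n _ ing]; exact: (@xgetI _ 1 [set n | i n = g] n ing).
Qed.

Lemma ext_proj_inj n : p (i n) = 1.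
Proof. by have : range i (i n) by []; rewrite (ext_exact e). Qed.

Lemma ext_comm : commutative (@mul N).
Proof. by move=> m n; apply: (ext_inj e); rewrite !gmulfM; exact: (ext_central e). Qed.

Definition ext_lift (h : H) : G := xget 1 [set g | p g = h].

Lemma ext_liftK h : p (ext_lift h) = h.
Proof. by have [g pg] := ext_surj e h; exact: (@xgetI _ 1 [set g | p g = h] g pg). Qed.

Definition restr_fun (a : autN i) (n : N) : N := ext_pull (a (i n)).
Definition induced_fun (a : autN i) (h : H) : H := p (a (ext_lift h)).

Lemma restr_funE a n : i (restr_fun a n) = a (i n).
Proof.
apply: ext_pullK; have : range i (a (i n)).
  by rewrite -(autN_stab a); exists (i n).
by rewrite (ext_exact e).
Qed.

Lemma induced_funE a g : induced_fun a (p g) = p (a g).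
Proof.
have : range i (ext_lift (p g) / g) by rewrite (ext_exact e) /ker /= gmulfF ext_liftK divgg.
move=> [n _ ing]; rewrite /induced_fun.
have -> : ext_lift (p g) = i n * g by rewrite ing mulgVK.
by rewrite autM gmulfM -restr_funE ext_proj_inj mul1g.
Qed.

Lemma autN_VK (a : autN i) g : a^-1 (a g) = g.
Proof. exact: (aut_VK (a : aut G) g). Qed.
Lemma autN_KV (a : autN i) g : a (a^-1 g) = g.
Proof. exact: (aut_KV (a : aut G) g). Qed.

Lemma restr_is_aut a : is_aut (restr_fun a).
Proof.
split; last first.
  by move=> m n; apply: (ext_inj e); rewrite gmulfM !restr_funE gmulfM autM.
by exists (restr_fun a^-1) => n; apply: (ext_inj e);
  rewrite !restr_funE ?autN_VK ?autN_KV.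
Qed.

Lemma induced_is_aut a : is_aut (induced_fun a).
Proof.
split; last first.
  move=> x y; rewrite -[x]ext_liftK -[y]ext_liftK -gmulfM !induced_funE.
  by rewrite autM gmulfM.
by exists (induced_fun a^-1) => x; rewrite -[x]ext_liftK;
  rewrite !induced_funE ?autN_VK ?autN_KV.
Qed.

Definition restr a : aut N := mk_aut (restr_is_aut a).
Definition induced a : aut H := mk_aut (induced_is_aut a).

Lemma restrE a n : i (restr a n) = a (i n). Proof. exact: restr_funE. Qed.
Lemma inducedE a g : induced a (p g) = p (a g). Proof. exact: induced_funE. Qed.

Definition tau (a : autN i) : aut N * aut H := (restr a, induced a).

Lemma tau_morphism : monoid_morphism tau.
Proof.
have tauM : {morph tau : a b / a * b}.
  move=> a b; congr pair; apply: aut_ext => x; rewrite aut_mulE.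
    by apply: (ext_inj e); rewrite !restrE.
  by rewrite -[x]ext_liftK !inducedE ext_liftK.
by split=> //; exact: mulg_morph1 tauM.
Qed.

HB.instance Definition _ := isUMagmaMorphism.Build _ _ tau tau_morphism.

Record left_transversal (t : H -> G) : Prop := {
  transversalK : forall x, p (t x) = x;
  transversal1 : t 1 = 1
}.

Variable t : H -> G.
Hypothesis tP : left_transversal t.

Definition ext_mu (x y : H) : N := ext_pull ((t (x * y))^-1 * (t x * t y)).

Lemma ext_muE x y : t (x * y) * i (ext_mu x y) = t x * t y.
Proof.
by rewrite ext_pullK ?mulVKg // !(gmulfM, gmulfV) !(transversalK tP) mulVg.
Qed.

Lemma ext_mu_cocycle : is_cocycle ext_mu.
Proof.
split=> [x|x|x y z]; apply: (ext_inj e).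
- by apply: (mulgI (t (x * 1))); rewrite ext_muE (transversal1 tP) gmulf1 !mulg1.
- by apply: (mulgI (t (1 * x))); rewrite ext_muE (transversal1 tP) gmulf1 !mul1g mulg1.
- apply: (mulgI (t (x * y * z))); rewrite !gmulfM !mulgA ext_muE.
  rewrite -!mulgA -(ext_central e (ext_mu x y) (t z)) !mulgA ext_muE.
  by rewrite -[in RHS](mulgA x) ext_muE -!mulgA ext_muE.
Qed.

Definition lambda_fun (a : aut N * aut H) (x y : H) : N :=
  ext_mu (a.2 x) (a.2 y) * (a.1 (ext_mu x y))^-1.

Lemma lambda_cocycle a : is_cocycle (lambda_fun a).
Proof.
case: a => th ph; have [mr ml mM] := ext_mu_cocycle.
split=> [x|x|x y z]; rewrite /lambda_fun /=.
- by rewrite aut1 !mr aut1 divgg.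
- by rewrite aut1 !ml aut1 divgg.
rewrite [LHS](mulgACA_comm ext_comm) [RHS](mulgACA_comm ext_comm).
by rewrite -!(invgM_comm ext_comm) -!(autM th) mM !autM mM.
Qed.

Definition lambda (a : aut N * aut H) : H2 H ext_comm :=
  coh_class (mk_cocycle ext_comm (lambda_cocycle a)).

End CentralExtension.

(* Main.v *)
(** Every [g] in [G] is uniquely [t x * i n]. An automorphism [a] preserving [N]
    and inducing [(th, ph)] satisfies [a (t x) = t (ph x) * i (c x)] for some
    [c : H -> N]; multiplicativity of [a] on products [t x * t y] says exactly
    that [lambda (th, ph)] is the coboundary of [c^-1]. Conversely, from
    [lambda (th, ph)] equal to the coboundary of [chi], the formula
    [t x * i n |-> t (ph x) * i ((chi x)^-1 * th n)] defines an automorphism. *)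
Require Import Defs.
From HB Require Import structures.
From mathcomp Require Import all_boot.
From mathcomp Require Import boolp classical_sets.

Local Open Scope classical_set_scope.
Local Open Scope group_scope.

Section TransversalCoordinates.
Variables (N G H : groupType).
Variables (i : UMagmaMorphism.type N G) (p : UMagmaMorphism.type G H).
Hypothesis e : central_extension i p.
Variable t : H -> G.
Hypothesis tP : left_transversal p t.

Local Notation mu := (@ext_mu N G H i t).

(** The [N]-coordinate of [g]; the argument of [ext_pull] lies in [ker p], so its default value
    never occurs. *)
Definition ext_coord (g : G) : N := ext_pull i ((t (p g))^-1 * g).

Lemma ext_coordK g : t (p g) * i (ext_coord g) = g.
Proof.
by rewrite (ext_pullK e) ?mulVKg // gmulfM gmulfV (transversalK tP) mulVg.
Qed.

Lemma ext_coord_proj x n : p (t x * i n) = x.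
Proof. by rewrite gmulfM (transversalK tP) (ext_proj_inj e) mulg1. Qed.

Lemma ext_coordE x n : ext_coord (t x * i n) = n.
Proof.
apply: (ext_inj e); apply: (mulgI (t x)).
by rewrite -{1}(ext_coord_proj x n) ext_coordK.
Qed.

(** Centrality moves [i m] past [t y], and [mu] absorbs [t x * t y]. *)
Lemma ext_coordM x y m n :
  t x * i m * (t y * i n) = t (x * y) * i (mu x y * (m * n)).
Proof.
rewrite !gmulfM [in RHS]mulgA (ext_muE e tP) !mulgA; congr (_ * _).
by rewrite -!mulgA (ext_central e m (t y)).
Qed.

(** Links the shape required by [is_coboundary], for the inverse of [c], to what comparing
    [N]-coordinates of products yields. Commutativity of [N] makes them equivalent, and each
    direction serves one inclusion of exactness. *)
Lemma lambda_funE (th : aut N) (ph : aut H) (c : H -> N) x y :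
  lambda_fun i t (th, ph) x y = (c x)^-1 * (c y)^-1 * ((c (x * y))^-1)^-1 <->
  c (x * y) * th (mu x y) = mu (ph x) (ph y) * (c x * c y).
Proof.
have comm := ext_comm e.
rewrite /lambda_fun /= invgK -(invgM_comm comm); split=> [E|E].
  by rewrite (comm (mu _ _)) -[mu (ph x) _](mulgVK (th (mu x y))) E -(mulgA _^-1) mulVKg.
by apply: (mulIg (th (mu x y))); rewrite mulgVK -mulgA E (comm (mu _ _)) mulKg.
Qed.

Lemma tau_coboundary (a : autN i) : is_coboundary (lambda_fun i t (tau e a)).
Proof.
pose th := restr e a; pose ph := induced e a.
pose c x := ext_coord (a (t x)).
have aE x n : a (t x * i n) = t (ph x) * i (c x * th n).
  rewrite autM -(restrE e) -(ext_coordK (a (t x))) -(inducedE e).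
  by rewrite (transversalK tP) gmulfM mulgA.
have c1 : c 1 = 1.
  have := ext_coordE 1 1; rewrite gmulf1 mulg1 (transversal1 tP) => c1.
  by rewrite /c (transversal1 tP) aut1.
exists (fun x => (c x)^-1); split=> [|x y]; first by rewrite c1 invg1.
apply/lambda_funE.
(* With trivial [N]-coordinates, the only [th] factor left is [th (mu x y)]. *)
have := autM a (t x * i 1) (t y * i 1).
rewrite ext_coordM !aE ext_coordM !aut1 !mulg1 -autM.
by move/(congr1 ext_coord); rewrite !ext_coordE.
Qed.

Lemma coboundary_tau (th : aut N) (ph : aut H) :
  is_coboundary (lambda_fun i t (th, ph)) -> exists a, tau e a = (th, ph).
Proof.
move=> [chi [chi1 chiE]]; pose c x := (chi x)^-1.
have c1 : c 1 = 1 by rewrite /c chi1 invg1.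
have cE x y : c (x * y) * th (mu x y) = mu (ph x) (ph y) * (c x * c y).
  by apply/lambda_funE; rewrite chiE /c !invgK.
pose f g := t (ph (p g)) * i (c (p g) * th (ext_coord g)).
(* The inverse of [f], found by solving for [x], then for [n], with [chi x] cancelling [c x]. *)
pose f' g := t (ph^-1 (p g)) * i (th^-1 (chi (ph^-1 (p g)) * ext_coord g)).
have fE x n : f (t x * i n) = t (ph x) * i (c x * th n).
  by rewrite /f ext_coord_proj ext_coordE.
have fP : is_aut f.
  split; last first.
    move=> g h; rewrite -(ext_coordK g) -(ext_coordK h).
    rewrite ext_coordM !fE ext_coordM -(autM ph); congr (t _ * i _).
    (* [cE] produces the [mu] factor; it remains to swap [c y] with [th] of the coordinate of
       [g]. *)
    rewrite (autM th (mu _ _)) (autM th (ext_coord g)) mulgA cE -mulgA.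
    by congr (_ * _); exact: (mulgACA_comm (ext_comm e)).
  exists f' => g.
    rewrite /f' /f !(ext_coord_proj, ext_coordE) aut_VK /c mulVKg aut_VK.
    exact: ext_coordK.
  rewrite /f' /f !(ext_coord_proj, ext_coordE) !aut_KV /c mulKg.
  exact: ext_coordK.
(* Here the normalizations [t 1 = 1] and [chi 1 = 1] enter. *)
have fi n : f (i n) = i (th n).
  by have := fE 1 n; rewrite !aut1 (transversal1 tP) c1 !mul1g.
have fN : stab_pred i (mk_aut fP).
  apply/asboolP/seteqP; split=> g.
    by move=> [_ [n _ <-] <-]; exists (th n); rewrite //= fi.
  by move=> [n _ <-]; exists (i (th^-1 n)); [exists (th^-1 n) | rewrite /= fi aut_KV].
exists (AutN fN); congr pair; apply: aut_ext => x.
  by apply: (ext_inj e); rewrite restrE -fi.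
by rewrite -[x](transversalK tP) inducedE /= /f ext_coord_proj.
Qed.

End TransversalCoordinates.

Theorem theorem2 (N G H : groupType)
    (i : UMagmaMorphism.type N G) (p : UMagmaMorphism.type G H)
    (e : central_extension i p) (t : H -> G) (tP : left_transversal p t) :
  [/\ exact_at (fun _ : unit => 1) (@incl N G H i p),
      exact_at (@incl N G H i p) (tau e)
    & exact_at (tau e) (lambda e tP)].
Proof.
split; apply/seteqP; split.
- by move=> _ [_ _ <-]; apply: val_inj.
- by move=> a /(congr1 (@autN_val _ _ i)) a1; exists tt => //; exact/esym/val_inj.
- move=> _ [a _ <-]; have /asboolP[aN aH] := autNH_valP a.
  apply: (congr2 pair); apply: aut_ext => x; first by apply: (ext_inj e); rewrite restrE.
  by have [g <-] := ext_surj e x; rewrite inducedE.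
- move=> a ta1; have aN : restr e a = 1 := congr1 fst ta1.
  have aH : induced e a = 1 := congr1 snd ta1.
  (* The two components of [tau e a = 1] are the two halves of [fix_pred]. *)
  have aP : fix_pred i p a.
    by apply/asboolP; split=> x; rewrite -?(restrE e) ?aN // -(inducedE e) aH.
  by exists (AutNH aP) => //; exact: val_inj.
- by move=> _ [a _ <-]; apply/coh_class_eq1/tau_coboundary.
- move=> [th ph] /coh_class_eq1 cb.
  have [a <-] : exists a, tau e a = (th, ph) by exact: coboundary_tau cb.
  by exists a.
Qed.
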